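(* Let $p$ be a prime and $t\geq 1$ an integer. The sequence $(\mathfrak{S}_{p^t}(n))_{n\geq 1}$ is eventually periodic if and only if $p=2$ and $t=2^s$ for some integer $s\geq 0$; and, in that case, it is periodic.
   Context: For an integer $b\geq 2$ and a positive integer $n$, $L_b(n)\in\{1,\dots,b-1\}$ denotes the last non-zero digit of $n$ in base $b$; that is, writing $n=b^r n'$ with $r\geq 0$ and $b\nmid n'$, $L_b(n)$ is the residue of $n'$ modulo $b$. Define $\mathfrak{S}_b(n):=L_b(n^n)$. A sequence $a(n)$, $n\geq 1$, is eventually periodic if there are $n_0$ and $T\geq 1$ with $a(n+T)=a(n)$ for all $n\geq n_0$; it is periodic if this holds with $n_0=1$. *)

(* Defs.v *)
From mathcomp Require Import all_boot.

Set Implicit Arguments.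
Unset Strict Implicit.
Unset Printing Implicit Defensive.

(* The exponent r of the largest power of b dividing n, for b >= 2 and n >= 1
   (b ^ r %| n then forces r < n).  The library's logn b n is not usable here:
   it is 0 when b is not prime. *)
Definition base_val (b n : nat) : nat := \max_(r < n.+1 | b ^ r %| n) r.

(* Meaningful for b >= 2 and n >= 1 only; see last_digitE. *)
Definition last_digit (b n : nat) : nat := (n %/ b ^ base_val b n) %% b.

Definition last_digit_self_power (b n : nat) : nat := last_digit b (n ^ n).

(* Sequences are indexed by n >= 1; the value a 0 is never inspected. *)
Definition periodic_from (n0 : nat) (a : nat -> nat) : Prop :=
  exists T : nat, 0 < T /\ forall n : nat, n0 <= n -> a (n + T) = a n.

Definition eventually_periodic (a : nat -> nat) : Prop :=
  exists n0 : nat, 0 < n0 /\ periodic_from n0 a.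

Definition periodic (a : nat -> nat) : Prop := periodic_from 1 a.

Lemma base_valE (b r m : nat) :
  1 < b -> 0 < m -> ~~ (b %| m) -> base_val b (b ^ r * m) = r.
Proof.
move=> b1 m0 bm; have b0 : 0 < b by exact: ltnW.
apply/eqP; rewrite eqn_leq; apply/andP; split.
  apply/bigmax_leqP => -[i /= _] hi; rewrite leqNgt; apply/negP => lt_ri.
  move: hi; rewrite -(subnKC lt_ri) expnD expnS [b * _]mulnC -mulnA.
  rewrite dvdn_pmul2l ?expn_gt0 ?b0 // => h; case/negP: bm.
  by apply: dvdn_trans h; apply: dvdn_mulr.
have hr : r < (b ^ r * m).+1.
  by rewrite ltnS (leq_trans (ltnW (ltn_expl r b1))) // leq_pmulr.
exact: (@leq_bigmax_cond _ _ _ (Ordinal hr) (dvdn_mulr m (dvdnn (b ^ r)))).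
Qed.

Lemma last_digitE (b r m : nat) :
  1 < b -> 0 < m -> ~~ (b %| m) -> last_digit b (b ^ r * m) = m %% b.
Proof.
move=> b1 m0 bm; rewrite /last_digit base_valE // mulKn //.
by rewrite expn_gt0 ltnW.
Qed.

(* Main.v *)
Require Import Defs.
From mathcomp Require Import all_boot.
From mathcomp Require Import cyclic.

(** Write n = p ^ v * m with p not dividing m, and b = p ^ t.  Then n ^ n is
    p ^ (v * n) * m ^ n, so its last non-zero digit in base b is
    p ^ e * m ^ n modulo p ^ t, with e = v * n modulo t
    ([last_digit_self_powerE]).  The digit thus determines both e, as its p-adic
    valuation, and, when e = 0, the residue of m ^ n modulo p.

    Suppose T = p ^ a * u is a period, with p not dividing u, and compare
    n = p ^ v * m for v > a with n + T, whose valuation is only a: the valuation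
    and the unit part of n can be varied freely while those of n + T are
    essentially fixed.  Two contradictions come out of this.  If a prime q != p
    divides t, take T divisible by q; comparing the exponents e gives
    v * n = a * n modulo q, which fails for n = p ^ v and v = a + 1 modulo q
    ([prime_dvd_of_eventually_periodic]).  Hence t is a power of p.  In that
    case take T and n divisible by t, so that all the exponents e vanish;
    comparing digits modulo p shows that m ^ n modulo p takes the same value for
    m = 1 and m = 2p - 1, that is 1 = -1 modulo p, hence p = 2
    ([eq2_of_eventually_periodic]).

    Conversely, let p = 2 and t = 2 ^ s.  Translation by 2 ^ (2t) leaves
    v, n modulo 2 ^ t and m modulo 2 ^ t unchanged when v < t.  When v >= t, both
    t and the order of every unit modulo 2 ^ t divide n, so the digit is 1
    ([periodic_power_of_two]). *)

(** * The last digit of n ^ n in a prime power base *)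

Lemma logn_expM_coprime (p e m : nat) :
  prime p -> ~~ (p %| m) -> logn p (p ^ e * m) = e.
Proof.
move=> hp pm.
have m0 : 0 < m by case: m pm => //; rewrite dvdn0.
have pe0 : 0 < p ^ e by rewrite expn_gt0 prime_gt0.
by rewrite lognM // pfactorK // [logn p m]lognE hp m0 (negbTE pm) addn0.
Qed.

Lemma prime_ndvdX (p m n : nat) : prime p -> ~~ (p %| m) -> ~~ (p %| m ^ n).
Proof. by move=> hp; rewrite Euclid_dvdX //; apply: contra => /andP[]. Qed.

Lemma last_digit_self_powerE (p t v m : nat) :
  prime p -> 0 < t -> ~~ (p %| m) ->
  last_digit_self_power (p ^ t) (p ^ v * m) =
    (p ^ (v * (p ^ v * m) %% t) * m ^ (p ^ v * m)) %% p ^ t.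
Proof.
move=> hp t0 pm; rewrite /last_digit_self_power expnMn -expnM.
set n := p ^ v * m; have pmn := prime_ndvdX _ _ n hp pm.
have mn0 : 0 < m ^ n by case: (m ^ n) pmn => //; rewrite dvdn0.
rewrite {1}(divn_eq (v * n) t) expnD -mulnA [_ * t]mulnC expnM.
apply: last_digitE.
- by rewrite -(exp1n t) ltn_exp2r // prime_gt1.
- by rewrite muln_gt0 mn0 expn_gt0 (prime_gt0 hp).
rewrite pfactor_dvdn // ?muln_gt0 ?mn0 ?expn_gt0 ?(prime_gt0 hp) //.
by rewrite logn_expM_coprime // -ltnNge ltn_mod.
Qed.

(** The residue modulo p ^ t loses no information on the exponent e < t. *)
Lemma logn_mod_pfactor (p t e m : nat) :
  prime p -> e < t -> ~~ (p %| m) -> logn p ((p ^ e * m) %% p ^ t) = e.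
Proof.
move=> hp et pm.
have m0 : 0 < m by case: m pm => //; rewrite dvdn0.
rewrite -(subnKC (ltnW et)) expnD -muln_modr logn_expM_coprime //.
by rewrite /dvdn modn_dvdm // -{1}(expn1 p) dvdn_exp2l // subn_gt0.
Qed.

(** When v > a, adding p ^ a * u brings the valuation of p ^ v * m down to a,
    and the unit part becomes p ^ (v - a) * m + u, which is u modulo p. *)
Lemma last_digit_self_power_shiftE (p t v m a u : nat) :
  prime p -> 0 < t -> ~~ (p %| u) -> a < v ->
  let n := p ^ v * m + p ^ a * u in
  last_digit_self_power (p ^ t) n =
    (p ^ (a * n %% t) * (p ^ (v - a) * m + u) ^ n) %% p ^ t.
Proof.
move=> hp t0 pu av n.
have -> : n = p ^ a * (p ^ (v - a) * m + u).
  by rewrite mulnDr mulnA -expnD subnKC // ltnW.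
apply: last_digit_self_powerE => //.
by rewrite dvdn_addr // dvdn_mulr // -{1}(expn1 p) dvdn_exp2l // subn_gt0.
Qed.

(** * Consequences of eventual periodicity *)

(** Multiples of a period are periods, so that any divisibility condition can be
    imposed on the period; its p-part is split off because it becomes the p-part
    of n + T as soon as n is divisible by a higher power of p. *)
Lemma eventually_periodic_multiple (p k : nat) (a : nat -> nat) :
  prime p -> 0 < k -> eventually_periodic a ->
  exists n0 r u, [/\ ~~ (p %| u), k %| p ^ r * u &
    forall n, n0 <= n -> a (n + p ^ r * u) = a n].
Proof.
move=> hp k0 [n0 [_ [T [T0 perT]]]].
have kT0 : 0 < k * T by rewrite muln_gt0 k0.
have [u pu ekT] := pfactor_coprime hp kT0.
exists n0, (logn p (k * T)), u; split.
- by rewrite -prime_coprime.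
- by rewrite mulnC -ekT dvdn_mulr.
move=> n n0n; rewrite [_ * u]mulnC -ekT.
elim: k {k0 kT0 ekT pu} => [|k IHk]; first by rewrite mul0n addn0.
by rewrite mulSnr addnA perT ?IHk // (leq_trans n0n) ?leq_addr.
Qed.

(** If q != p, the exponents v * n and a * n of the digits at n and n + T would
    agree modulo q for every large n = p ^ v, although v - a and n can both be
    made prime to q. *)
Lemma prime_dvd_of_eventually_periodic (p t q : nat) :
  prime p -> 0 < t -> eventually_periodic (last_digit_self_power (p ^ t)) ->
  prime q -> q %| t -> q = p.
Proof.
move=> hp t0 ep hq qt; apply/eqP/negPn/negP => qp.
have [n0 [a [u [pu qT per]]]] :=
  eventually_periodic_multiple _ q _ hp (prime_gt0 hq) ep.
(* q * n0 is there to push n past n0 without changing v modulo q. *)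
set v := (a + 1) + q * n0.
have av : a < v by rewrite /v addn1 ltnS leq_addr.
have pn1 : ~~ (p %| 1) by rewrite dvdn1 gtn_eqF // prime_gt1.
have n0n : n0 <= p ^ v * 1.
  rewrite muln1 (leq_trans _ (ltnW (ltn_expl v (prime_gt1 hp)))) //.
  by rewrite /v (leq_trans (leq_pmull n0 (prime_gt0 hq))) // leq_addl.
move: (per _ n0n).
rewrite last_digit_self_power_shiftE // last_digit_self_powerE //.
move/(congr1 (logn p)); rewrite !logn_mod_pfactor ?ltn_mod //; first last.
- apply: prime_ndvdX => //; rewrite dvdn_addr // dvdn_mulr //.
  by rewrite -{1}(expn1 p) dvdn_exp2l // subn_gt0.
- by apply: prime_ndvdX.
move/(congr1 (modn^~ q)); rewrite !(modn_dvdm _ qt) muln1.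
rewrite mulnDr -modnDmr -modnMmr (eqP qT) muln0 mod0n addn0.
have -> : v * p ^ v = n0 * p ^ v * q + (a * p ^ v + p ^ v).
  by rewrite {1}/v !mulnDl mul1n addnC [q * n0]mulnC mulnAC.
rewrite modnMDl -{1}[a * _]addn0 => /eqP; rewrite eqn_modDl eq_sym mod0n.
by rewrite -/(q %| _) Euclid_dvdX // dvdn_prime2 // (negbTE qp).
Qed.

Lemma fermat_expn (p x k : nat) :
  prime p -> ~~ (p %| x) -> x ^ (p.-1 * k) = 1 %[mod p].
Proof.
move=> hp px; rewrite expnM -modnXm.
rewrite -totient_prime // Euler_exp_totient ?modnXm ?exp1n //.
by rewrite coprime_sym prime_coprime.
Qed.

(** This is the fact that an odd power of -1 is -1. *)
Lemma odd_expn_predn (d n : nat) : 0 < d -> odd n -> d.-1 ^ n = d.-1 %[mod d].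
Proof.
case: d => // d _ oddn /=.
have sq : d ^ 2 = 1 %[mod d.+1].
  case: d => // d; have -> : d.+1 ^ 2 = d * d.+2 + 1.
    by rewrite -mulnn mulSn [d * d.+2]mulnS addn1.
  by rewrite modnMDl.
rewrite -(odd_double_half n) oddn add1n expnS -mul2n expnM -modnMmr -modnXm sq.
by rewrite modnXm exp1n modnMmr muln1.
Qed.

(** When t divides T and n, all the exponents e vanish.  The digits of n + T
    for n = p ^ v and n = p ^ v * (2p - 1) agree modulo p by Fermat's theorem,
    because the two values of n agree modulo p - 1; those of n are 1 and -1. *)
Lemma eq2_of_eventually_periodic (p s : nat) :
  prime p -> eventually_periodic (last_digit_self_power (p ^ (p ^ s))) -> p = 2.
Proof.
move=> hp; set t := p ^ s => ep.
have t0 : 0 < t by rewrite expn_gt0 prime_gt0.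
have [n0 [a [u [pu tT per]]]] := eventually_periodic_multiple _ t _ hp t0 ep.
set v := (a + s + n0).+1.
have av : a < v by rewrite /v ltnS -addnA leq_addr.
have digit_modp m : 0 < m -> ~~ (p %| m) ->
    m ^ (p ^ v * m) = u ^ (p ^ v * m + p ^ a * u) %[mod p].
  move=> m0 pm.
  have n0n : n0 <= p ^ v * m.
    apply: leq_trans (leq_pmulr _ m0).
    apply: leq_trans (ltnW (ltn_expl v (prime_gt1 hp))).
    by rewrite /v leqW // leq_addl.
  have tn : t %| p ^ v * m.
    by rewrite dvdn_mulr // dvdn_exp2l // /v leqW // addnAC leq_addl.
  move: (per _ n0n).
  rewrite last_digit_self_power_shiftE // last_digit_self_powerE //.
  have -> : v * (p ^ v * m) %% t = 0 by apply/eqP; apply: dvdn_mull.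
  have -> : a * (p ^ v * m + p ^ a * u) %% t = 0.
    by apply/eqP; rewrite -/(dvdn t _) dvdn_mull // dvdn_add.
  rewrite !mul1n => /(congr1 (modn^~ p)).
  have pt : p %| p ^ t by rewrite -{1}(expn1 p) dvdn_exp2l.
  rewrite !(modn_dvdm _ pt) => <-.
  rewrite -[in LHS]modnXm -[in LHS]modnDml.
  have -> : (p ^ (v - a) * m) %% p = 0.
    apply/eqP; rewrite -/(dvdn p _) dvdn_mulr // -{1}(expn1 p).
    by rewrite dvdn_exp2l // subn_gt0.
  by rewrite add0n modnXm.
have p1 := prime_gt1 hp.
have pn1 : ~~ (p %| 1) by rewrite dvdn1 gtn_eqF.
have em : (p.-1).*2.+1 = p + p.-1.
  by rewrite -addnn -addSn (prednK (prime_gt0 hp)).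
have pm : ~~ (p %| (p.-1).*2.+1).
  rewrite em dvdn_addr // gtnNdvd ?ltn_predL ?(prime_gt0 hp) //.
  by rewrite -ltnS (prednK (prime_gt0 hp)).
have pred0 : 0 < p.-1 by rewrite -ltnS (prednK (prime_gt0 hp)).
have := digit_modp (p.-1).*2.+1 isT pm.
have -> : p ^ v * (p.-1).*2.+1 + p ^ a * u =
          p.-1 * (2 * p ^ v) + (p ^ v * 1 + p ^ a * u).
  rewrite addnA; congr (_ + _); rewrite mulnS muln1 addnC -mul2n mulnCA mulnA.
  by rewrite mulnC mulnA.
rewrite expnD -modnMml fermat_expn // modnMml mul1n -digit_modp // exp1n.
case: (even_prime hp) => // oddp.
rewrite -modnXm em modnDl modnXm -em odd_expn_predn ?(prime_gt0 hp) //; last first.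
  by rewrite oddM oddX oddp orbT /= odd_double.
move/eqP; rewrite eqn_mod_dvd // subn1 => /dvdn_leq.
by case: (p) p1 oddp => [|[|[|k]]] //= _ _ /(_ isT); rewrite ltnNge leqW.
Qed.

(** * The case of the base 2 ^ (2 ^ s) *)

(** The odd residues modulo 2 ^ t form a group of order 2 ^ (t - 1). *)
Lemma odd_expn_mod2X (t m n : nat) :
  odd m -> 2 ^ t %| n -> m ^ n = 1 %[mod 2 ^ t].
Proof.
case: t => [|t] mo; first by rewrite !modn1.
case/dvdnP => k ->; rewrite mulnC {1}expnSr -mulnA expnM.
have e1 : m ^ (2 ^ t) = 1 %[mod 2 ^ t.+1].
  have -> : 2 ^ t = totient (2 ^ t.+1) by rewrite totient_pfactor //= mul1n.
  by rewrite Euler_exp_totient // coprimeXr // coprimen2.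
by rewrite -modnXm e1 modnXm exp1n.
Qed.

Lemma periodic_power_of_two (s : nat) :
  periodic (last_digit_self_power (2 ^ (2 ^ s))).
Proof.
set t := 2 ^ s; have t0 : 0 < t by rewrite expn_gt0.
have tt : t %| 2 ^ t by rewrite dvdn_exp2l // ltnW // ltn_expl.
exists (2 ^ (2 * t)); split; first by rewrite expn_gt0.
have deep n : 0 < n -> 2 ^ t %| n -> last_digit_self_power (2 ^ t) n = 1 %% 2 ^ t.
  move=> n0 tn; have [m] := pfactor_coprime (isT : prime 2) n0.
  rewrite coprime2n mulnC => mo en; rewrite {1}en.
  rewrite last_digit_self_powerE // ?dvdn2 ?mo // -en.
  have -> : logn 2 n * n %% t = 0.
    by apply/eqP; rewrite -/(dvdn t _) dvdn_mull // (dvdn_trans tt).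
  by rewrite mul1n odd_expn_mod2X.
have tT : 2 ^ t %| 2 ^ (2 * t) by rewrite dvdn_exp2l // leq_pmull.
move=> n n0; have [tn|tn] := boolP (2 ^ t %| n).
  by rewrite !deep // ?dvdn_add // addn_gt0 n0.
have [m] := pfactor_coprime (isT : prime 2) n0.
rewrite coprime2n mulnC => mo en; set v := logn 2 n in en.
have vt : v < t by rewrite ltnNge; move: tn; rewrite pfactor_dvdn.
set d := 2 * t - v.
have td : 2 ^ t %| 2 ^ d.
  by rewrite dvdn_exp2l // /d mul2n -addnn -addnBA ?leq_addr // ltnW.
have d0 : 2 %| 2 ^ d by apply: dvdn_trans td; rewrite -{1}(expn1 2) dvdn_exp2l.
have en' : n + 2 ^ (2 * t) = 2 ^ v * (m + 2 ^ d).
  by rewrite mulnDr -en -expnD subnKC // (leq_trans (ltnW vt)) // leq_pmull.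
have mo' : odd (m + 2 ^ d) by rewrite oddD mo -[odd (2 ^ d)]negbK -dvdn2 d0.
rewrite en' last_digit_self_powerE // ?dvdn2 ?mo' //.
rewrite en last_digit_self_powerE // ?dvdn2 ?mo' ?mo // -en -en'.
have -> : v * (n + 2 ^ (2 * t)) %% t = v * n %% t.
  rewrite mulnDr -modnDmr; have -> : v * 2 ^ (2 * t) %% t = 0.
    by apply/eqP; rewrite -/(dvdn t _) dvdn_mull // (dvdn_trans tt).
  by rewrite addn0.
rewrite -modnMmr -[in RHS]modnMmr; congr ((_ * _) %% _).
rewrite expnD -modnMmr odd_expn_mod2X // modnMmr muln1 -modnXm -modnDmr.
by rewrite (eqP td) addn0 modnXm.
Qed.

Theorem theorem7 (p t : nat) (hp : prime p) (ht : 1 <= t) :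
  (eventually_periodic (last_digit_self_power (p ^ t)) <->
     p = 2 /\ exists s : nat, t = 2 ^ s) /\
  (p = 2 /\ (exists s : nat, t = 2 ^ s) ->
     periodic (last_digit_self_power (p ^ t))).
Proof.
have per : p = 2 /\ (exists s : nat, t = 2 ^ s) ->
    periodic (last_digit_self_power (p ^ t)).
  by case=> -> [s ->]; apply: periodic_power_of_two.
split=> //; split=> [ep|/per]; last by exists 1.
have [s et] : exists s, t = p ^ s.
  exists (logn p t); rewrite -p_part part_pnat_id //.
  apply/pnatP => // q hq qt.
  by rewrite inE /= (prime_dvd_of_eventually_periodic _ _ _ hp ht ep hq qt).
rewrite et in ep; have p2 := eq2_of_eventually_periodic _ _ hp ep.
by split=> //; exists s; rewrite et p2.
Qed.
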